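(* Let $r<r_g(\nu_d(\mathbb{RP}^n))$, where $r_g(\nu_d(\mathbb{RP}^n))$ is the complex generic symmetric rank of $\mathsf{S}^d(\mathbb{C}^{n+1})$. If $\mathsf{S}^d(\mathbb{C}^{n+1})$ is $r$-identifiable, then $\mathsf{S}^d(\mathbb{R}^{n+1})$ is $r$-identifiable.
   Context: For $\mathbb{K}=\mathbb{R}$ or $\mathbb{C}$, $\mathsf{S}^d(\mathbb{K}^{n+1})$ is the space of symmetric $d$-tensors over $\mathbb{K}^{n+1}$. The Veronese variety $\nu_d(\mathbb{KP}^n)$ is the projective variety of symmetric rank-one tensors; its affine cone consists of the tensors $\lambda v^{\otimes d}$ with $\lambda\in\mathbb{K}$, $v\in\mathbb{K}^{n+1}$. The symmetric rank over $\mathbb{K}$ of $T\in\mathsf{S}^d(\mathbb{K}^{n+1})$ is the minimum number of elements of this affine cone summing to $T$. The complex generic rank $r_g(\nu_d(\mathbb{RP}^n))$ is the integer $s$ such that the set of tensors of complex symmetric rank $s$ contains a nonempty Zariski open subset of $\mathsf{S}^d(\mathbb{C}^{n+1})$. A symmetric rank-$r$ decomposition (Waring decomposition) over $\mathbb{K}$ of $T$ is an expression $T=\sum_{i=1}^r T_i$ with $r$ the symmetric rank of $T$ over $\mathbb{K}$ and each $T_i$ in the affine cone over $\mathbb{K}$; it is unique if the unordered set $\{T_1,\dots,T_r\}$ is unique. $\mathsf{S}^d(\mathbb{K}^{n+1})$ is $r$-identifiable if a general symmetric tensor of symmetric rank $r$ over $\mathbb{K}$ has a unique symmetric rank-$r$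 decomposition over $\mathbb{K}$. Here ''a general point of a semialgebraic set $S$ has property $\mathscr{P}$'' means that the points of $S$ not having $\mathscr{P}$ are contained in a semialgebraic subset $C\subseteq S$ with $\dim C<\dim S$ (in the complex case, the exceptional points are contained in a subvariety of smaller dimension than that of the Zariski closure of the set of symmetric rank-$r$ tensors). *)

(* Defs.v *)
From HB Require Import structures.
From mathcomp Require Import all_boot all_order all_algebra all_fingroup.
From mathcomp Require Import mpoly complex.
From mathcomp Require Import boolp classical_sets reals.

Set Implicit Arguments.
Unset Strict Implicit.
Unset Printing Implicit Defensive.

Import Order.TTheory GRing.Theory Num.Theory.
Local Open Scope ring_scope.
Local Open Scope classical_set_scope.

(* K^I, for a finite index type I, is {ffun I -> K}; a polynomial function on
   it is an element of {mpoly K[#|I|]}, whose i-th variable is the coordinate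
   enum_val i. *)
Section AffineSpace.
Variables (K : fieldType) (I : finType).
Implicit Types (x : {ffun I -> K}) (f : {mpoly K[#|I|]}).
Implicit Types (A B S Z : set {ffun I -> K}).

Definition peval f x : K := f.@[fun i => x (enum_val i)].

Definition vanishing_ideal A : set {mpoly K[#|I|]} :=
  [set f | forall x, A x -> peval f x = 0].

Definition zero_locus (F : set {mpoly K[#|I|]}) : set {ffun I -> K} :=
  [set x | forall f, F f -> peval f x = 0].

Definition zariski_closed Z : Prop := exists F, Z = zero_locus F.

Definition zariski_closure A : set {ffun I -> K} :=
  zero_locus (vanishing_ideal A).

(* dim A is the Krull dimension of K[X]/I(A).  The prime ideals of this
   quotient are those of K[X] that contain I(A), hence the chains
   P 0 < ... < P m below.  Only P 0, ..., P m are relevant. *)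
Definition prime_chain A (m : nat) : Prop :=
  exists P : nat -> {pred {mpoly K[#|I|]}},
    [/\ forall i, (i <= m)%N -> idealr_closed (P i) /\ prime_idealr_closed (P i),
        forall f, vanishing_ideal A f -> f \in P 0%N
      & forall i, (i < m)%N ->
          {subset P i <= P i.+1} /\ exists2 f, f \in P i.+1 & f \notin P i].

Definition is_dim A (e : nat) : Prop :=
  prime_chain A e /\ forall m, prime_chain A m -> (m <= e)%N.

(* dim A < dim B.  The empty set has no prime chain: its dimension is smaller
   than every natural number. *)
Definition dim_lt A B : Prop :=
  exists2 e, is_dim B e & forall m, prime_chain A m -> (m < e)%N.

(* A general point of S, in the algebraic sense, has property P. *)
Definition general_point S (P : {ffun I -> K} -> Prop) : Prop :=
  exists Z, [/\ zariski_closed Z,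
                Z `<=` zariski_closure S,
                dim_lt Z (zariski_closure S)
              & forall x, S x -> ~ P x -> Z x].

End AffineSpace.

Section Semialgebraic.
Variables (R : rcfType) (I : finType).

Inductive semialgebraic : set {ffun I -> R} -> Prop :=
| semialgebraic_gt0 (f : {mpoly R[#|I|]}) :
    semialgebraic [set x | 0 < peval f x]
| semialgebraic_setU A B :
    semialgebraic A -> semialgebraic B -> semialgebraic (A `|` B)
| semialgebraic_setI A B :
    semialgebraic A -> semialgebraic B -> semialgebraic (A `&` B)
| semialgebraic_setC A : semialgebraic A -> semialgebraic (~` A).

(* A general point of S, in the semialgebraic sense, has property P. *)
Definition semialg_general_point (S : set {ffun I -> R})
    (P : {ffun I -> R} -> Prop) : Prop :=
  exists C, [/\ semialgebraic C, C `<=` S, dim_lt C S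
              & forall x, S x -> ~ P x -> C x].

End Semialgebraic.

Section SymmetricTensors.
Variables (K : fieldType) (n d : nat).

(* Coordinate arrays of d-tensors over K^{n+1}. *)
Definition tensor := {ffun d.-tuple 'I_n.+1 -> K}.

Definition sym_tensors : set tensor :=
  [set T | forall (s : 'S_d) (t : d.-tuple 'I_n.+1),
     T [tuple tnth t (s k) | k < d] = T t].

Definition tensor_power (v : 'rV[K]_n.+1) : tensor :=
  [ffun t : d.-tuple 'I_n.+1 => \prod_(k < d) v 0 (tnth t k)].

(* The affine cone over the Veronese variety. *)
Definition veronese_cone : set tensor :=
  [set T | exists (lambda : K) (v : 'rV[K]_n.+1),
     T = [ffun t => lambda * tensor_power v t]].

Definition is_decomp (T : tensor) (r : nat) (s : r.-tuple tensor) : Prop :=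
  (forall i : 'I_r, veronese_cone (tnth s i)) /\ T = \sum_(i < r) tnth s i.

Definition has_srank (T : tensor) (r : nat) : Prop :=
  (exists s : r.-tuple tensor, is_decomp T s) /\
  (forall (q : nat) (s : q.-tuple tensor), is_decomp T s -> (r <= q)%N).

Definition srank_set (r : nat) : set tensor := [set T | has_srank T r].

(* Meant for T of symmetric rank r; perm_eq compares unordered families. *)
Definition has_unique_decomp (r : nat) (T : tensor) : Prop :=
  exists2 s : r.-tuple tensor, is_decomp T s
    & forall s' : r.-tuple tensor, is_decomp T s' -> perm_eq s s'.

(* The Zariski open subsets of sym_tensors are the sets sym_tensors `\` Z with
   Z closed in the ambient space of all tensors. *)
Definition is_generic_srank (g : nat) : Prop :=
  exists Z : set tensor,
    [/\ zariski_closed Z, sym_tensors `\` Z !=set0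
      & sym_tensors `\` Z `<=` srank_set g].

End SymmetricTensors.

Definition complex_identifiable (R : realType) (n d r : nat) : Prop :=
  general_point (@srank_set (R[i] : fieldType) n d r) (has_unique_decomp r).

Definition real_identifiable (R : realType) (n d r : nat) : Prop :=
  semialg_general_point (@srank_set R n d r) (has_unique_decomp r).

(* Main.v *)
Require Import Defs.
From mathcomp Require Import all_boot all_order all_algebra all_fingroup.
From mathcomp Require Import zify.
From mathcomp Require ordered_qelim qe_rcf.
From mathcomp Require Import mpoly complex.
From mathcomp Require Import boolp classical_sets reals.

(* Fix the parametrization of the sums of r cone elements by polynomials with
   natural coefficients.  As r < g, some complex polynomial h1 vanishes on all
   tensors of complex rank < r but not on all sums of r cone elements; by
   hypothesis some complex h2 vanishes on the exceptional set Z but not on all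
   tensors of rank r.  The pullback of h1 * h2 to the parameter space is a
   nonzero polynomial, hence does not vanish at some natural, a fortiori real,
   point.  A real polynomial f with the same real zeros as h1 * h2 therefore
   does not vanish on the real tensors of real rank r, but it does where
   uniqueness fails: there either the complex rank drops, or two real
   decompositions are two complex ones.  The exceptional set is thus the
   semialgebraic set srank_set r `&` [f = 0].  The ideal of srank_set r is
   prime, so it prolongs every chain of primes above the ideal of the
   exceptional set; a maximal chain exists because K[X_1, ..., X_N] has finite
   Krull dimension. *)

Set Implicit Arguments.
Unset Strict Implicit.
Unset Printing Implicit Defensive.

Import Order.TTheory GRing.Theory Num.Theory.
Local Open Scope ring_scope.

(** * Polynomials viewed in their last variable; nonvanishing at natural points *)

Section LastVariable.
Variables (n : nat) (R : comNzRingType).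
Local Notation widen := (widen_ord (leqnSn n)).

Lemma mmap_muni (A : comNzRingType) (f : {rmorphism R -> A})
    (h : 'I_n.+1 -> A) (p : {mpoly R[n.+1]}) :
  mmap f h p = (map_poly (mmap f (h \o widen)) (muni p)).[h ord_max].
Proof.
rewrite muniE raddf_sum /= horner_sum [LHS]/mmap; apply: eq_bigr => m _.
rewrite map_polyZ hornerZ map_polyXn hornerXn /= mmapZ mmapX -mulrA.
congr (_ * _); rewrite /mmap1 big_ord_recr /=; congr (_ * _).
by apply: eq_bigr => i _; rewrite mnmE.
Qed.

(** No coefficient is lost: [p@_m] is found in [muni p] at degree [m ord_max], then at the
    restriction of [m] to the first [n] variables. *)
Lemma muni_eq0 (p : {mpoly R[n.+1]}) : (muni p == 0) = (p == 0).
Proof.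
apply/eqP/eqP => [p0|->]; last exact: muni0.
apply/mpolyP => m; rewrite mcoeff0.
have := congr1 (fun q : {poly {mpoly R[n]}} =>
  q`_(m ord_max)@_[multinom (m (widen i)) | i < n]) p0.
rewrite muniE coef0 mcoeff0 coef_sum raddf_sum /=.
have rew m' : (p@_m' *: 'X_[[multinom m' (widen i) | i < n]]
    *: 'X^(m' ord_max) : {poly {mpoly R[n]}})`_(m ord_max)
    @_[multinom m (widen i) | i < n] = p@_m' * (m' == m)%:R.
  rewrite coefZ coefXn -scalerAl mcoeffZ; congr (_ * _).
  rewrite mulr_natr mcoeffMn mcoeffX -mulrnA mulnb; congr (_ %:R); congr nat_of_bool.
  apply/andP/eqP => [[/eqP /mnmP e1 /eqP e2]|->]; last by rewrite !eqxx.
  apply/mnmP => i; case: (unliftP ord_max i) => [j ->|->]; last by rewrite e2.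
  have := e1 j; rewrite !mnmE; congr (_ = _); congr (_ _); apply: val_inj => /=;
    by rewrite /bump leqNgt ltn_ord.
under eq_bigr do rewrite rew.
have [mp|/memN_msupp_eq0 //] := boolP (m \in msupp p).
rewrite (bigD1_seq m) //= eqxx mulr1 big1 ?addr0 // => m' /negPf ->.
by rewrite mulr0.
Qed.

End LastVariable.

Lemma mpoly0_const (R : nzRingType) (p : {mpoly R[0]}) : p = (p@_0)%:MP.
Proof.
apply/mpolyP => m; have -> : m = 0%MM by apply/mnmP; case.
by rewrite mcoeffC eqxx mulr1.
Qed.

(** The naturals below [size p] are pairwise distinct in a [numDomainType], too many to be all roots
    of [p]. *)
Lemma poly_neq0_nat (R : numDomainType) (p : {poly R}) :
  p != 0 -> exists k : nat, p.[k%:R] != 0.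
Proof.
move=> p0; apply: contrapT => /forallNP pk.
have /max_poly_roots := p0.
move=> /(_ [seq k%:R | k <- iota 0 (size p)]).
rewrite size_map size_iota ltnn => H; suff : false by []; apply: H.
  apply/allP => _ /mapP[k _ ->]; apply/rootP/eqP/negPn/negP; exact: pk.
rewrite map_inj_uniq ?iota_uniq //; exact: mulrIn (oner_neq0 R).
Qed.

(** Induction on [n]: a nonzero coefficient of [muni p] fixes the first variables, then a non-root
    fixes the last. Natural points make sense over every ring at once, which serves to pass from
    complex to real tensors. *)
Lemma mpoly_neq0_nat (R : numDomainType) n (p : {mpoly R[n]}) :
  p != 0 -> exists v : 'I_n -> nat, p.@[fun i => (v i)%:R] != 0.
Proof.
elim: n p => [|n IHn] p p0.
  exists (fun=> 0%N); rewrite (mpoly0_const p) mevalC.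
  by apply: contraNneq p0 => p00; rewrite (mpoly0_const p) p00.
have [k pk] : exists k, (muni p)`_k != 0.
  by exists (size (muni p)).-1; rewrite -lead_coefE lead_coef_eq0 muni_eq0.
have [v pv] := IHn _ pk.
set q := map_poly (mmap idfun (fun i => (v i)%:R)) (muni p).
have q0 : q != 0.
  apply: contraNneq pv => /(congr1 (fun r : {poly R} => r`_k)).
  by rewrite coef_map coef0 => /eqP.
have [x qx] := poly_neq0_nat q0.
exists (fun i => if unlift ord_max i is Some j then v j else x).
apply: contraNneq qx; rewrite /meval mmap_muni unlift_none => /eqP.
congr (_.[_] == _); apply: eq_map_poly => r; rewrite /mmap; apply: eq_bigr => m _.
congr (_ * _); apply: mmap1_eq => i /=; congr (_ %:R).
have -> : widen_ord (leqnSn n) i = lift ord_max i; last by rewrite liftK.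
by apply: val_inj => /=; rewrite /bump leqNgt ltn_ord.
Qed.

(** * Bound on the Krull dimension of polynomial rings; strict drop of dimension *)

Section KrullDimension.
Variable K : fieldType.

Lemma ideal0 (A : nzRingType) (P : {pred A}) : idealr_closed P -> 0 \in P.
Proof. by case. Qed.

Lemma idealM (A : nzRingType) (P : {pred A}) a u :
  idealr_closed P -> u \in P -> a * u \in P.
Proof. by case=> P0 _ PD uP; rewrite -[a * u]addr0 PD. Qed.

Lemma idealD (A : nzRingType) (P : {pred A}) u v :
  idealr_closed P -> u \in P -> v \in P -> u + v \in P.
Proof. by case=> _ _ PD uP vP; rewrite -[u]mul1r PD. Qed.

Lemma prime_idealX (A : nzRingType) (P : {pred A}) u k :
  idealr_closed P -> prime_idealr_closed P -> u ^+ k \in P -> u \in P.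
Proof.
move=> [_ P1 _] pP; elim: k => [|k IHk]; first by rewrite (negPf P1).
by rewrite exprS => /pP/orP[].
Qed.

(* The last variable is evaluated at an element of P 1 outside P 0, so the
   lowest nonzero coefficient of q with respect to it lies in P 1. *)
Lemma prime_chain_no_relation (A : comNzRingType) (f : {rmorphism K -> A})
    k (P : nat -> {pred A}) (x : 'I_k -> A) (q : {mpoly K[k]}) :
    (forall i, (i <= k)%N -> idealr_closed (P i) /\ prime_idealr_closed (P i)) ->
    (forall i, (i < k)%N -> {subset P i <= P i.+1}) ->
    (forall j : 'I_k, x j \in P (k - j)%N /\ x j \notin P (k - j).-1) ->
  q != 0 -> mmap f x q \notin P 0%N.
Proof.
elim: k P x q => [|k IHk] P x q prP subP xP q0.
  rewrite (mpoly0_const q) mmapC; have [P0 pP0] := prP 0%N isT.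
  apply/negP => /(idealM (f (q@_0)^-1) P0); rewrite -rmorphM mulVf ?rmorph1.
    by apply/negP; case: P0.
  by apply: contraNneq q0 => q00; rewrite (mpoly0_const q) q00.
have [I0 pI0] := prP 0%N isT; have [I1 pI1] := prP 1%N isT.
rewrite mmap_muni; set Q := muni q.
have Q0 : Q != 0 by rewrite muni_eq0.
(* The largest power of the last variable that divides [Q] is factored out. *)
have [a [Q' Q'0 QE]] : exists a,
    exists2 Q' : {poly {mpoly K[k]}}, Q'`_0 != 0 & Q = Q' * 'X^a.
  have exQ : exists i, Q`_i != 0.
    by exists (size Q).-1; rewrite -lead_coefE lead_coef_eq0.
  have [a Qa aP] := ex_minnP exQ.
  exists a, (drop_poly a Q); first by rewrite coef_drop_poly.
  rewrite -[LHS](poly_take_drop a).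
  suff -> : take_poly a Q = 0 by rewrite add0r.
  apply/polyP => i; rewrite coef_take_poly coef0; case: ifP => // ia.
  by apply/eqP; apply: contraTT ia => /aP; rewrite -leqNgt.
rewrite QE rmorphM /= map_polyXn hornerM hornerXn mulrC.
(* As [x ord_max] is outside the prime [P 0], the value of [Q'] is in [P 0], hence in [P 1]. There
   the terms of positive degree in the last variable are multiples of [x ord_max], so the value of
   the constant coefficient is in [P 1] too. *)
apply/negP => /pI0/orP[/(prime_idealX I0 pI0)|].
  by case: (xP ord_max) => _; rewrite subSnn => /negP.
move/(subP 0%N isT).
have [xm _] := xP ord_max; rewrite subSnn in xm.
rewrite -[Q'](poly_take_drop 1) rmorphD hornerD rmorphM /= map_polyXn.
rewrite hornerM hornerXn expr1 => H.
have {H} : mmap f (x \o widen_ord (leqnSn k)) Q'`_0 \in P 1%N.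
  set u := _.[_] in H; set v := _ * _ in H.
  have -> : mmap f (x \o widen_ord (leqnSn k)) Q'`_0 = u.
    rewrite /u; suff -> : take_poly 1 Q' = (Q'`_0)%:P by rewrite map_polyC hornerC.
    by apply/polyP => i; rewrite coef_take_poly coefC; case: i.
  have -> : u = (-1) * v + (u + v) by rewrite mulN1r addrCA addNr addr0.
  by apply: (idealD I1) => //; do 2 apply: (idealM _ I1).
(* The chain from [P 1] on serves the remaining [k] variables. *)
apply/negP; apply: (IHk (fun i => P i.+1)) => //.
- by move=> i ik; apply: prP.
- by move=> i ik; apply: subP.
move=> j; have := xP (widen_ord (leqnSn k) j) => /=.
by rewrite subSn 1?ltnW //= prednK // subn_gt0.
Qed.

Lemma msizeM_pred N (p q : {mpoly K[N]}) :
  (msize (p * q) <= (msize p + msize q).-1)%N.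
Proof.
have [->|p0] := eqVneq p 0; first by rewrite mul0r msize0.
have [->|q0] := eqVneq q 0; first by rewrite mulr0 msize0.
by rewrite msizeM.
Qed.

(** Dimension count: the [D ^ N.+1] monomials in the [x i] with exponents below [D] take values in
    the span of the [L ^ N] monomials with exponents below [L], a space of smaller dimension. *)
Lemma algebraic_dependence N (x : 'I_N.+1 -> {mpoly K[N]}) :
  exists2 q : {mpoly K[N.+1]}, q != 0 & mmap (@mpolyC N K) x q = 0.
Proof.
pose c := (\max_i msize (x i))%N.
(* Since [L ^ N] is [(N.+1 * c).+1 ^ N * D ^ N], this choice of [D] makes it less than
   [D ^ N.+1]. *)
pose D := ((N.+1 * c).+1 ^ N).+1.
pose L := ((N.+1 * c).+1 * D)%N.
have LD : (L ^ N < D ^ N.+1)%N.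
  by rewrite expnMn expnS ltn_mul2r expn_gt0 /= ltnSn.
pose E := {ffun 'I_N.+1 -> 'I_D}; pose F := {ffun 'I_N -> 'I_L}.
pose mn (e : E) : 'X_{1..N.+1} := [multinom val (e i) | i < N.+1].
pose mf (e : F) : 'X_{1..N} := [multinom val (e i) | i < N].
pose M := \matrix_(i < #|E|, j < #|F|)
  (mmap1 x (mn (enum_val i)))@_(mf (enum_val j)).
have : kermx M != 0.
  rewrite -mxrank_eq0 mxrank_ker subn_eq0 -ltnNge.
  apply: leq_ltn_trans (rank_leq_col _) _.
  by rewrite !card_ffun !card_ord.
case/rowV0Pn => w /sub_kermxP wM w0.
pose q := \sum_(e : E) w 0 (enum_rank e) *: 'X_[mn e].
have mn_inj : injective mn.
  by move=> e e' /mnmP ee'; apply/ffunP => i; apply: val_inj; have := ee' i; rewrite !mnmE.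
exists q.
  apply: contraNneq w0 => q0; apply/eqP/rowP => i; rewrite mxE.
  have := congr1 (fun q : {mpoly K[N.+1]} => q@_(mn (enum_val i))) q0.
  rewrite mcoeff0 raddf_sum /= (bigD1 (enum_val i)) //= mcoeffZ mcoeffX eqxx.
  rewrite mulr1 enum_valK big1 ?addr0 // => e ei.
  by rewrite mcoeffZ mcoeffX (inj_eq mn_inj) (negPf ei) mulr0.
have qE : mmap (@mpolyC N K) x q =
    \sum_(i < #|E|) w 0 i *: mmap1 x (mn (enum_val i)).
  rewrite /q raddf_sum /= (reindex (@enum_val E E)) /=; last first.
    by exists enum_rank => i _; rewrite ?enum_valK ?enum_rankK.
  by apply: eq_bigr => i _; rewrite enum_valK mmapZ mmapX mul_mpolyC.
rewrite qE; apply/mpolyP => m; rewrite mcoeff0 raddf_sum /=.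
(* The columns of [M] see only exponents below [L]; a monomial with a larger one has too high a
   degree to occur. *)
have [mL|] := boolP [forall i, (m i < L)%N]; last first.
  rewrite negb_forall => /fintype.existsP exm.
  case: exm => i; rewrite -leqNgt => Lmi.
  rewrite big1 // => k _; rewrite mcoeffZ [X in _ * X]memN_msupp_eq0 ?mulr0 //.
  apply: msize_mdeg_ge; apply: leq_trans (leq_trans Lmi _); last first.
    by rewrite mdegE (bigD1 i) //= leq_addr.
  rewrite /mmap1; move: (enum_val k) => e.
  have : (msize (\prod_(i < N.+1) x i ^+ mn e i) <= (\sum_(i < N.+1) c * D).+1)%N.
    elim/big_rec2: _ => [|j b p _ IH]; first by rewrite msize1.
    apply: leq_trans (msizeM_pred _ _) _.
    have xX d : (msize (x j ^+ d) <= (c * d).+1)%N.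
      elim: d => [|d IHd]; first by rewrite expr0 msize1.
      rewrite exprS; apply: leq_trans (msizeM_pred _ _) _.
      have : (msize (x j) <= c)%N by apply: leq_bigmax.
      by rewrite mulnS; lia.
    have ejD : (c * e j <= c * D)%N by rewrite leq_mul2l (ltnW (ltn_ord _)) orbT.
    have : (msize (x j ^+ mn e j) <= (c * D).+1)%N.
      by apply: leq_trans (xX _) _; rewrite mnmE.
    by move: IH; clear; lia.
  move/leq_trans; apply; rewrite sum_nat_const card_ord /L; nia.
pose m' : F := [ffun i => Ordinal (fintype.forallP mL i)].
have -> : m = mf m' by apply/mnmP => i; rewrite mnmE ffunE.
have := congr1 (fun A : 'rV_ _ => A 0 (enum_rank m')) wM.
rewrite !mxE => {2}<-; apply: eq_bigr => k _.
by rewrite mcoeffZ mxE enum_rankK.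
Qed.

(** In a longer chain, elements chosen in [#|I|.+1] successive differences would be algebraically
    dependent; but the value of the relation is 0, which lies in [P 0], against
    [prime_chain_no_relation]. *)
Lemma prime_chain_bound (I : finType) (A : set {ffun I -> K}) m :
  prime_chain A m -> (m <= #|I|)%N.
Proof.
case=> P [prP _ subP]; rewrite leqNgt; apply/negP => mI.
have /choice[x xP] (j : 'I_#|I|.+1) : exists f,
    f \in P (#|I|.+1 - j)%N /\ f \notin P (#|I|.+1 - j).-1.
  have jm : ((#|I|.+1 - j).-1 < m)%N by have := ltn_ord j; lia.
  have [_ [f fP fP']] := subP _ jm; exists f; split => //.
  by rewrite prednK // in fP; have := ltn_ord j; lia.
have [q q0 qx] := algebraic_dependence x.
have prP' i : (i <= #|I|.+1)%N -> idealr_closed (P i) /\ prime_idealr_closed (P i).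
  by move=> iI; apply: prP; apply: leq_trans mI.
have [I0 _] := prP' 0%N isT.
have := prime_chain_no_relation (@mpolyC #|I| K) prP' _ xP q0.
rewrite qx ideal0 // => H; suff : false by []; apply: H => i iI.
by case: (subP i (leq_trans iI mI)).
Qed.

End KrullDimension.

(** The ideal of [S] is a proper prime, and [f] separates it from the ideal of [C]. Put in front of
    a chain for [C], it gives a chain for [S] that is longer by one. The dimension of [S] exists by
    [prime_chain_bound]. *)
Lemma dim_lt_prime (K : fieldType) (I : finType) (C S : set {ffun I -> K})
    (f : {mpoly K[#|I|]}) :
    (C `<=` S)%classic -> (exists x, S x) ->
    (forall a b, vanishing_ideal S (a * b) ->
       vanishing_ideal S a \/ vanishing_ideal S b) ->
  vanishing_ideal C f -> ~ vanishing_ideal S f -> dim_lt C S.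
Proof.
move=> CS [x0 Sx0] prS Cf Sf.
pose P0 : {pred {mpoly K[#|I|]}} := fun a => `[< vanishing_ideal S a >].
have P0P : idealr_closed P0 /\ prime_idealr_closed P0.
  split; last by move=> a b /asboolP/prS[] ab; apply/orP; [left|right]; apply/asboolP.
  split; first by apply/asboolP => x _; rewrite /peval raddf0.
    apply/negP => /asboolP/(_ x0 Sx0)/eqP; apply/negP.
    by rewrite /peval rmorph1 oner_neq0.
  move=> a u v /asboolP Su /asboolP Sv; apply/asboolP => x Sx.
  by rewrite /peval rmorphD rmorphM /= -!/(peval _ _) Su // Sv // mulr0 addr0.
have exP : exists m, `[< prime_chain S m >].
  by exists 0%N; apply/asboolP; exists (fun=> P0); split=> // a Sa; apply/asboolP.
have bnd m : `[< prime_chain S m >] -> (m <= #|I|)%N.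
  by move/asboolP/prime_chain_bound.
have [e /asboolP Se maxe] := ex_maxnP exP bnd.
exists e; first by split=> // m Sm; apply/maxe/asboolP.
move=> m [P [prP subP chP]]; apply/maxe/asboolP.
exists (fun i => if i is j.+1 then P j else P0); split.
- by case=> // i; apply: prP.
- by move=> a Sa; apply/asboolP.
case=> [_|i]; last exact: chP.
split=> [a /asboolP Sa|]; first by apply: subP => x /CS; exact: Sa.
by exists f; [exact: subP | apply/asboolP].
Qed.

(** * Tarski-Seidenberg: images of polynomial maps are semialgebraic *)

Module ord := ordered_qelim.ord.

Section TarskiSeidenberg.
Variable R : rcfType.

Lemma nth_codom_ord (M : nat) (v : 'I_M -> R) (i : 'I_M) : (codom v)`_i = v i.
Proof. by rewrite (nth_map i) ?size_enum_ord // nth_ord_enum. Qed.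

(** The shift [s] leaves the first [s] variables of the environment to the coordinates of the image
    point. *)
Lemma mpoly_term (M s : nat) (p : {mpoly R[M]}) :
  exists t : GRing.term R,
    forall e, GRing.eval e t = p.@[fun i : 'I_M => e`_(s + i)].
Proof.
pose has_term (q : {mpoly R[M]}) := exists t : GRing.term R,
  forall e, GRing.eval e t = q.@[fun i : 'I_M => e`_(s + i)].
have termC c : has_term c%:MP by exists (GRing.Const c) => e; rewrite mevalC.
have termM q1 q2 : has_term q1 -> has_term q2 -> has_term (q1 * q2).
  move=> [t1 t1P] [t2 t2P]; exists (GRing.Mul t1 t2) => e.
  by rewrite rmorphM /= t1P t2P.
rewrite (mpolyE p); elim/big_ind: _ => [|q1 q2 [t1 t1P] [t2 t2P]|m _].
- by have := termC 0; rewrite mpolyC0.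
- by exists (GRing.Add t1 t2) => e; rewrite raddfD /= t1P t2P.
rewrite -mul_mpolyC; apply: (termM) (termC _) _.
rewrite mpolyXE_id; elim/big_ind: _ => [|q1 q2|i _]; last 1 first.
- exists (GRing.Exp (GRing.Var R (s + i)) (m i)) => e.
  by rewrite rmorphXn /= mevalXU.
- by have := termC 1; rewrite mpolyC1.
- exact: termM.
Qed.

Variable I : finType.
Implicit Types (A B : set {ffun I -> R}) (x : {ffun I -> R}).

Definition env x := codom (fun i : 'I_#|I| => x (enum_val i)).

Lemma term_mpoly (t : GRing.term R) : GRing.rterm t ->
  exists p : {mpoly R[#|I|]}, forall x, peval p x = GRing.eval (env x) t.
Proof.
elim: t => //=.
- move=> k _; have [kI|kI] := ltnP k #|I|.
    exists 'X_(Ordinal kI) => x; rewrite /peval mevalXU.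
    by rewrite -[k]/(nat_of_ord (Ordinal kI)) nth_codom_ord.
  (* A variable beyond the end of the environment takes the default value 0. *)
  by exists 0 => x; rewrite /peval raddf0 nth_default // size_codom card_ord.
- by move=> c _; exists c%:MP => x; rewrite /peval mevalC.
- by move=> k _; exists k%:R => x; rewrite /peval rmorph_nat.
- move=> t1 IH1 t2 IH2 /andP[/IH1[p1 p1P] /IH2[p2 p2P]].
  by exists (p1 + p2) => x; rewrite -p1P -p2P /peval raddfD.
- by move=> t1 IH1 /IH1[p1 p1P]; exists (- p1) => x; rewrite -p1P /peval raddfN.
- move=> t1 IH1 k /IH1[p1 p1P]; exists (p1 *+ k) => x.
  by rewrite -p1P /peval raddfMn.
- move=> t1 IH1 t2 IH2 /andP[/IH1[p1 p1P] /IH2[p2 p2P]].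
  by exists (p1 * p2) => x; rewrite -p1P -p2P /peval rmorphM.
- move=> t1 IH1 k /IH1[p1 p1P]; exists (p1 ^+ k) => x.
  by rewrite -p1P /peval rmorphXn.
Qed.

Local Open Scope classical_set_scope.

Lemma semialgebraic_eq0 (p : {mpoly R[#|I|]}) :
  semialgebraic [set x | peval p x = 0].
Proof.
have pN x : peval (- p) x = - peval p x by rewrite /peval raddfN.
have -> : [set x | peval p x = 0] =
    ~` ([set x | 0 < peval p x] `|` [set x | 0 < peval (- p) x]).
  apply/seteqP; split => x /=; rewrite /setC /setU /= pN oppr_gt0.
    by move=> p0 [] /=; rewrite p0 ltxx.
  by move=> H; case: (ltgtP (peval p x) 0) => // p0; case: H; [right|left].
by apply/semialgebraic_setC/semialgebraic_setU; apply: semialgebraic_gt0.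
Qed.

Lemma semialgebraicT : semialgebraic [set: {ffun I -> R}].
Proof.
have -> : [set: {ffun I -> R}] = [set x | peval (0 : {mpoly R[#|I|]}) x = 0].
  by apply/seteqP; split => x //= _; rewrite /peval raddf0.
exact: semialgebraic_eq0.
Qed.

Lemma semialgebraic_bigcap m (A : nat -> set {ffun I -> R}) :
    (forall q, semialgebraic (A q)) ->
  semialgebraic [set x | forall q, (q < m)%N -> A q x].
Proof.
move=> sA; elim: m => [|m IHm].
  have -> : [set x | forall q, (q < 0)%N -> A q x] = setT by apply/seteqP; split.
  exact: semialgebraicT.
have -> : [set x | forall q, (q < m.+1)%N -> A q x] =
    A m `&` [set x | forall q, (q < m)%N -> A q x].
  apply/seteqP; split=> x /= => [H|[Hm H] q].
    by split=> [|q qm]; apply: H => //; apply: ltnW.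
  by rewrite ltnS leq_eqVlt => /orP[/eqP->//|]; apply: H.
exact: semialgebraic_setI.
Qed.

Lemma semialgebraic_qf (f : ord.formula R) :
  ord.qf_form f && ord.rformula f ->
  semialgebraic [set x | ord.qf_eval (env x) f].
Proof.
have sub t1 t2 : GRing.rterm t1 && GRing.rterm t2 -> exists p : {mpoly R[#|I|]},
    forall x, peval p x = GRing.eval (env x) t2 - GRing.eval (env x) t1.
  case/andP=> /term_mpoly[p1 p1P] /term_mpoly[p2 p2P].
  by exists (p2 - p1) => x; rewrite -p1P -p2P /peval raddfB.
elim: f => //=.
- case=> _; first by rewrite (_ : mkset _ = setT); [exact: semialgebraicT|apply/seteqP; split].
  rewrite (_ : mkset _ = ~` setT); first exact/semialgebraic_setC/semialgebraicT.
  by apply/seteqP; split => x //= /(_ isT).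
- move=> t1 t2 /sub[p pP].
  rewrite (_ : mkset _ = [set x | peval p x = 0]); first exact: semialgebraic_eq0.
  apply/seteqP; split => x /=; rewrite pP; first by move/eqP->; rewrite subrr.
  by move/eqP; rewrite subr_eq0 eq_sym.
- move=> t1 t2 /sub[p pP].
  rewrite (_ : mkset _ = [set x | 0 < peval p x]); first exact: semialgebraic_gt0.
  by apply/seteqP; split => x /=; rewrite pP subr_gt0.
- move=> t1 t2; rewrite andbC => /sub[p pP].
  rewrite (_ : mkset _ = ~` [set x | 0 < peval p x]).
    exact/semialgebraic_setC/semialgebraic_gt0.
  by apply/seteqP; split => x /=; rewrite pP subr_gt0 leNgt => /negP.
- move=> f1 IH1 f2 IH2; rewrite andbACA => /andP[/IH1 s1 /IH2 s2].
  rewrite (_ : mkset _ = [set x | ord.qf_eval (env x) f1] `&`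
    [set x | ord.qf_eval (env x) f2]); first exact: semialgebraic_setI.
  by apply/seteqP; split => x /= => [/andP|/andP].
- move=> f1 IH1 f2 IH2; rewrite andbACA => /andP[/IH1 s1 /IH2 s2].
  rewrite (_ : mkset _ = [set x | ord.qf_eval (env x) f1] `|`
    [set x | ord.qf_eval (env x) f2]); first exact: semialgebraic_setU.
  by apply/seteqP; split => x /= => [/orP|/orP].
- move=> f1 IH1 f2 IH2; rewrite andbACA => /andP[/IH1 s1 /IH2 s2].
  rewrite (_ : mkset _ = ~` [set x | ord.qf_eval (env x) f1] `|`
    [set x | ord.qf_eval (env x) f2]); first exact/semialgebraic_setU/s2/semialgebraic_setC.
  apply/seteqP; split => x /=; rewrite implybE; first by case/orP=> [/negP|]; [left|right].
  by case=> [/negP->//|->]; rewrite orbT.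
- move=> f1 IH1 /IH1 s1.
  rewrite (_ : mkset _ = ~` [set x | ord.qf_eval (env x) f1]); first exact: semialgebraic_setC.
  by apply/seteqP; split => x /= => /negP.
Qed.

(** Quantifier elimination over real closed fields; [to_rform] first removes inverses, so that the
    atoms compare polynomials. *)
Lemma semialgebraic_holds (f : ord.formula R) :
  semialgebraic [set x | ord.holds (env x) f].
Proof.
pose proj k bc := qe_rcf.qfr_to_formula (@qe_rcf.wproj R k bc).
pose g := ord.quantifier_elim proj (ord.to_rform f).
rewrite (_ : mkset _ = [set x | ord.qf_eval (env x) g]).
  apply: semialgebraic_qf; apply: ord.quantifier_elim_wf; last exact: ord.to_rform_rformula.
  exact: qe_rcf.wf_QE_wproj.
by apply/seteqP; split=> x /= /(@qe_rcf.rcf_satP R).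
Qed.

(** Each quantified index is the current length of the environment, so assigning it appends a
    value. *)
Lemma holds_Existss (e : seq R) (f : ord.formula R) m :
  ord.holds e (foldr (@ord.Exists R) f (iota (size e) m)) <->
  exists2 s : seq R, size s = m & ord.holds (e ++ s) f.
Proof.
elim: m e => [|m IHm] e /=.
  by split=> [ef|[[]// _]]; [exists [::]; rewrite ?cats0|rewrite cats0].
have setE y : set_nth 0 e (size e) y = rcons e y by elim: e {IHm} => //= ? ? ->.
split=> [[y]|[[//|y s] [sm]]].
  rewrite setE -(size_rcons e y) => /IHm[s sm ef].
  by exists (y :: s); rewrite /= ?sm // -cat_rcons.
rewrite -cat_rcons => ef; exists y; rewrite setE -(size_rcons e y).
by apply/IHm; exists s.
Qed.

Lemma semialgebraic_image M (phi : I -> {mpoly R[M]}) :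
  semialgebraic [set x : {ffun I -> R} | exists v, forall i, x i = (phi i).@[v]].
Proof.
have [t tP] := choice (fun i => mpoly_term #|I| (phi i)).
(* Variables below [#|I|] stand for the point [x], the next [M] for the parameters [v]. *)
pose F := foldr (fun i f => ord.And (ord.Equal (GRing.Var R (enum_rank i)) (t i)) f)
  (ord.Bool true) (enum I).
have FP e : ord.holds e F <->
    forall i : I, e`_(enum_rank i) = (phi i).@[fun j : 'I_M => e`_(#|I| + j)].
  have : ord.holds e F <-> forall i, i \in enum I ->
      e`_(enum_rank i) = (phi i).@[fun j : 'I_M => e`_(#|I| + j)].
    rewrite /F; elim: (enum I) => [|i s IHs] /=; first by split.
    rewrite tP; split=> [[ei /IHs es] j|H].
      by rewrite inE => /orP[/eqP->//|]; apply: es.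
    split; first by apply: H; rewrite mem_head.
    by apply/IHs => j js; apply: H; rewrite inE js orbT.
  by move->; split=> H i => [|_]; apply: H; rewrite mem_enum.
rewrite (_ : mkset _ = [set x | ord.holds (env x)
  (foldr (@ord.Exists R) F (iota #|I| M))]); first exact: semialgebraic_holds.
have szx x : size (env x) = #|I| by rewrite size_codom card_ord.
have nthx x s (i : I) : (env x ++ s)`_(enum_rank i) = x i.
  by rewrite nth_cat szx ltn_ord nth_codom_ord enum_rankK.
have nths x s (j : 'I_M) : (env x ++ s)`_(#|I| + j) = s`_j.
  by rewrite nth_cat szx ltnNge leq_addr /= addKn.
apply/seteqP; split => x /=; rewrite -{1}(szx x) holds_Existss.
  move=> [v vP]; exists (codom v); first by rewrite size_codom card_ord.
  apply/FP => i; rewrite nthx vP; apply: meval_eq => j.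
  by rewrite nths nth_codom_ord.
move=> [s _ /FP H]; exists (fun j => s`_j) => i.
by have := H i; rewrite nthx => ->; apply: meval_eq => j; rewrite nths.
Qed.

End TarskiSeidenberg.

(** * Sums of [q] cone elements and their parametrization *)

Section ConeSums.
Variables (K : fieldType) (n d : nat).
Local Notation tensorK := (tensor K n d).
Implicit Types (T U : tensorK) (q : nat).

(** Minimality of [q] is not imposed: unlike the set of tensors of rank [q], this is the image of a
    polynomial map. *)
Definition cone_sumset q : set tensorK :=
  [set T | exists s : q.-tuple tensorK, is_decomp T s]%classic.

Lemma cone_sumsetD q1 q2 T U :
  cone_sumset q1 T -> cone_sumset q2 U -> cone_sumset (q1 + q2) (T + U).
Proof.
move=> [s [sc ->]] [u [uc ->]]; exists [tuple of s ++ u]; split=> [i|].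
  rewrite (tnth_nth 0) nth_cat size_tuple; case: (splitP i) => j ->.
    by rewrite -tnth_nth; exact: sc.
  by rewrite addKn -tnth_nth; exact: uc.
rewrite big_split_ord /=; congr (_ + _); apply: eq_bigr => i _;
  rewrite !(tnth_nth 0) nth_cat size_tuple /=; first by rewrite ltn_ord.
by rewrite ltnNge leq_addr addKn.
Qed.

Lemma cone_sumset_split q1 q2 T : cone_sumset (q1 + q2) T ->
  exists T1 T2, [/\ cone_sumset q1 T1, cone_sumset q2 T2 & T = T1 + T2].
Proof.
move=> [s [sc ->]]; rewrite big_split_ord /=; do 2 eexists; split; last by [].
  exists [tuple tnth s (lshift q2 i) | i < q1]; split=> [i|]; first by rewrite tnth_mktuple.
  by apply: eq_bigr => i _; rewrite tnth_mktuple.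
exists [tuple tnth s (rshift q1 i) | i < q2]; split=> [i|]; first by rewrite tnth_mktuple.
by apply: eq_bigr => i _; rewrite tnth_mktuple.
Qed.

Lemma cone_sumset_sym q T : cone_sumset q T -> sym_tensors T.
Proof.
move=> [s [sc ->]] p t; rewrite !sum_ffunE; apply: eq_bigr => i _.
have [lam [v ->]] := sc i; rewrite !ffunE; congr (_ * _).
rewrite [RHS](reindex_inj (@perm_inj _ p)) /=.
by apply: eq_bigr => k _; rewrite tnth_mktuple.
Qed.

Lemma has_srankE T r : has_srank T r <->
  cone_sumset r T /\ forall q, (q < r)%N -> ~ cone_sumset q T.
Proof.
split=> -[Tr Tmin]; split=> // q.
  by move=> qr [s /Tmin]; rewrite leqNgt qr.
by move=> s Ts; rewrite leqNgt; apply/negP => /Tmin; apply; exists s.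
Qed.

(** The index [(i, None)] carries the scalar of the [i]-th summand, [(i, Some k)] the [k]-th
    coordinate of its vector. *)
Definition cone_vars q := 'I_#|{: 'I_q * option 'I_n.+1}|.

Definition cone_poly q (t : d.-tuple 'I_n.+1) :
    {mpoly K[#|{: 'I_q * option 'I_n.+1}|]} :=
  \sum_(i < q) 'X_(enum_rank (i, None)) *
    \prod_(k < d) 'X_(enum_rank (i, Some (tnth t k))).

Definition cone_param q (v : cone_vars q -> K) : tensorK :=
  [ffun t => (cone_poly q t).@[v]].

Lemma cone_paramE q (v : cone_vars q -> K) t :
  cone_param v t = \sum_(i < q) v (enum_rank (i, None)) *
    \prod_(k < d) v (enum_rank (i, Some (tnth t k))).
Proof.
rewrite ffunE /cone_poly raddf_sum; apply: eq_bigr => i _ /=.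
rewrite rmorphM rmorph_prod /= mevalXU; congr (_ * _).
by apply: eq_bigr => k _; rewrite mevalXU.
Qed.

Lemma cone_sumsetP q T : cone_sumset q T <-> exists v, T = cone_param (q := q) v.
Proof.
split=> [[s [sc ->]]|[v ->]].
  have [lam /choice[w sE]] := choice sc.
  pose v (j : cone_vars q) := let: (i, o) := enum_val j in
    if o is Some k then w i 0 k else lam i.
  exists v; apply/ffunP => t; rewrite cone_paramE sum_ffunE; apply: eq_bigr => i _.
  rewrite sE !ffunE /v enum_rankK; congr (_ * _).
  by apply: eq_bigr => k _; rewrite enum_rankK.
pose s i : tensorK := [ffun t => v (enum_rank (i, None)) *
  tensor_power d (\row_k v (enum_rank (i, Some k))) t].
exists [tuple s i | i < q]; split=> [i|].
  by rewrite tnth_mktuple; do 2 eexists.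
apply/ffunP => t; rewrite cone_paramE sum_ffunE; apply: eq_bigr => i _.
rewrite tnth_mktuple !ffunE; congr (_ * _).
by apply: eq_bigr => k _; rewrite mxE.
Qed.

(** * Pullback to the parameter space, and separating polynomials *)

Definition cone_pullback q (a : {mpoly K[#|{: d.-tuple 'I_n.+1}|]}) :=
  a \mPo [tuple cone_poly q (enum_val i) | i < #|{: d.-tuple 'I_n.+1}|].

Lemma cone_pullbackE q a v : (cone_pullback q a).@[v] = peval a (cone_param v).
Proof.
rewrite comp_mpoly_meval; apply: meval_eq => i.
by rewrite tnth_mktuple ffunE.
Qed.

Lemma cone_pullback_neq0 q a T :
  cone_sumset q T -> peval a T != 0 -> cone_pullback q a != 0.
Proof.
move=> /cone_sumsetP[v ->]; rewrite -cone_pullbackE; apply: contraNneq => ->.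
by rewrite raddf0.
Qed.

(* If f vanishes where the rank is not g but not at T = T1 + T2, with T1 a sum
   of r cone elements and T2 a sum of g - r of them, translate f by T2. *)
Lemma generic_srank_separation r g : is_generic_srank K n d g -> (r < g)%N ->
  exists h : {mpoly K[#|{: d.-tuple 'I_n.+1}|]},
    (forall q T, (q < r)%N -> cone_sumset q T -> peval h T = 0) /\
    exists2 T, cone_sumset r T & peval h T != 0.
Proof.
move=> [Z [[F ->] [x0 [symx0 Zx0]] genF]] rg.
have [f [Ff fx0]] : exists f, F f /\ peval f x0 != 0.
  apply: contrapT => /forallNP fx0; apply: Zx0 => f Ff.
  by apply/eqP/negPn/negP => ?; apply: (fx0 f).
have /has_srankE[] := genF x0 (conj symx0 Zx0).
rewrite -(subnKC (ltnW rg)) => /cone_sumset_split[T1 [T2 [T1r T2r x0E]]] _.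
pose h := f \mPo [tuple 'X_i + (T2 (enum_val i))%:MP | i < #|{: d.-tuple 'I_n.+1}|].
have hE T : peval h T = peval f (T + T2).
  rewrite /peval /h comp_mpoly_meval; apply: meval_eq => i.
  by rewrite tnth_mktuple raddfD /= mevalXU mevalC ffunE.
exists h; split=> [q T qr Tq|]; last by exists T1 => //; rewrite hE -x0E.
(* [T + T2] is a sum of [q + (g - r)] cone elements, fewer than [g], so its rank is not [g]. *)
have TT2 := cone_sumsetD Tq T2r; rewrite hE; apply: contrapT => fT.
have /has_srankE[_ /(_ (q + (g - r))%N)] : srank_set g (T + T2).
  apply: genF; split; first exact: cone_sumset_sym TT2.
  by move=> /(_ f Ff).
by apply => //; lia.
Qed.

(** If all equations of [Z] vanished on [S], then [Z] would be the whole Zariski closure of [S],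
    against the drop of dimension. *)
Lemma general_point_separation (S : set tensorK) (P : tensorK -> Prop) :
  general_point S P -> exists h : {mpoly K[#|{: d.-tuple 'I_n.+1}|]},
    (forall T, S T -> ~ P T -> peval h T = 0) /\
    exists2 T, S T & peval h T != 0.
Proof.
move=> [Z [[F ZF] ZS [e [Se maxe] dimZ] SZ]].
have [h [Fh [T [ST hT]]]] : exists h, F h /\ exists T, S T /\ peval h T != 0.
  apply: contrapT => /forallNP FS.
  suff ZE : Z = zariski_closure S by have := dimZ e; rewrite ZE ltnn => /(_ Se).
  apply/seteqP; split=> // T ST; rewrite ZF => f Ff; apply: ST => U SU.
  by apply/eqP/negPn/negP => fU; apply: (FS f); split=> //; exists U.
by exists h; split; [move=> U SU PU; have := SZ U SU PU; rewrite ZF => /(_ h Fh)|exists T].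
Qed.

End ConeSums.

(** Irreducibility of [cone_sumset q]: the pullbacks are nonzero elements of an integral domain, so
    their product is nonzero at some natural point. *)
Lemma cone_param_nat_neq0 (K : numFieldType) n d q
    (s : seq {mpoly K[#|{: d.-tuple 'I_n.+1}|]}) :
    (forall a, a \in s -> exists2 T, cone_sumset q T & peval a T != 0) ->
  exists v : cone_vars n q -> nat,
    forall a, a \in s -> peval a (cone_param d (fun j => (v j)%:R)) != 0.
Proof.
move=> sP; have /mpoly_neq0_nat[v] : \prod_(a <- s) cone_pullback q a != 0.
  rewrite prodf_seq_neq0; apply/allP => a /sP[T Tq aT].
  exact: cone_pullback_neq0 Tq aT.
rewrite rmorph_prod prodf_seq_neq0 => /allP vP; exists v => a /vP /=.
by rewrite cone_pullbackE.
Qed.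

(** * Extension of scalars *)

Section TensorMap.
Variables (K L : fieldType) (f : {rmorphism K -> L}) (n d : nat).

Definition tensor_map (T : tensor K n d) : tensor L n d := [ffun t => f (T t)].

Lemma tensor_map_inj : injective tensor_map.
Proof.
move=> T U /ffunP TU; apply/ffunP => t; have := TU t.
by rewrite !ffunE => /fmorph_inj.
Qed.

Lemma is_decomp_map T r (s : r.-tuple (tensor K n d)) :
  is_decomp T s -> is_decomp (tensor_map T) (map_tuple tensor_map s).
Proof.
move=> [sc ->]; split=> [i|].
  rewrite tnth_map; have [lam [v ->]] := sc i; exists (f lam), (map_mx f v).
  apply/ffunP => t; rewrite !ffunE rmorphM rmorph_prod /=; congr (_ * _).
  by apply: eq_bigr => k _; rewrite mxE.
apply/ffunP => t; rewrite ffunE !sum_ffunE rmorph_sum; apply: eq_bigr => i _.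
by rewrite tnth_map ffunE.
Qed.

Lemma cone_sumset_map r T : cone_sumset r T -> cone_sumset r (tensor_map T).
Proof. by move=> [s Ts]; exists (map_tuple tensor_map s); exact: is_decomp_map. Qed.

(** Ring morphisms fix the naturals, and [cone_poly] has natural coefficients. *)
Lemma tensor_map_param_nat r (v : cone_vars n r -> nat) :
  tensor_map (cone_param d (fun j => (v j)%:R)) = cone_param d (fun j => (v j)%:R).
Proof.
apply/ffunP => t; rewrite ffunE !cone_paramE rmorph_sum; apply: eq_bigr => i _.
rewrite rmorphM rmorph_prod rmorph_nat; congr (_ * _).
by apply: eq_bigr => k _; rewrite rmorph_nat.
Qed.

(** Decompositions over [K] become decompositions over [L], where they agree up to order;
    [tensor_map] is injective. The hypothesis supplies one over [K], as the one over [L] need not a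
    priori come from [K]. *)
Lemma has_unique_decomp_map r T : cone_sumset r T ->
  has_unique_decomp r (tensor_map T) -> has_unique_decomp r T.
Proof.
move=> [s Ts] [u Tu uP]; exists s => // s' Ts'.
apply: (perm_map_inj tensor_map_inj).
have /= us := uP _ (is_decomp_map Ts); have /= us' := uP _ (is_decomp_map Ts').
by rewrite perm_sym in us; apply: perm_trans us us'.
Qed.

End TensorMap.

(** * From complex to real tensors *)

(** At real points the real and imaginary parts of [h] are real polynomials, obtained
    coefficientwise; [f] is the sum of their squares. *)
Lemma real_zero_locus_poly (R : rcfType) N (h : {mpoly R[i][N]}) :
  exists f : {mpoly R[N]},
    forall x, f.@[x] = 0 <-> h.@[fun i => real_complex R (x i)] = 0.
Proof.
have part (phi : R[i] -> R) :
    phi 0 = 0 -> {morph phi : y z / y + z} ->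
    (forall z c, phi (z * real_complex R c) = phi z * c) ->
    exists p : {mpoly R[N]},
      forall x, p.@[x] = phi h.@[fun i => real_complex R (x i)].
  move=> phi0 phiD phiZ; exists (\sum_(m <- msupp h) phi h@_m *: 'X_[m]) => x.
  rewrite raddf_sum [in RHS]mevalE (big_morph phi phiD phi0); apply: eq_bigr => m _.
  rewrite /= mevalZ mevalX -phiZ rmorph_prod /=; congr (phi (_ * _)).
  by apply: eq_bigr => i _; rewrite rmorphXn.
have [p pP] : exists p : {mpoly R[N]},
    forall x, p.@[x] = complex.Re h.@[fun i => real_complex R (x i)].
  by apply: part => [//|[a b] [a' b'] //|[a b] c] /=; rewrite mulr0 subr0.
have [q qP] : exists q : {mpoly R[N]},
    forall x, q.@[x] = complex.Im h.@[fun i => real_complex R (x i)].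
  by apply: part => [//|[a b] [a' b'] //|[a b] c] /=; rewrite mulr0 add0r.
exists (p ^+ 2 + q ^+ 2) => x; rewrite rmorphD !rmorphXn /= pP qP.
case: h.@[_] => a b /=; split=> [/eqP|[-> ->]]; last by rewrite expr0n addr0.
by rewrite paddr_eq0 ?sqr_ge0 // !sqrf_eq0 => /andP[/eqP-> /eqP->].
Qed.

(** A Boolean combination of the sets [cone_sumset q], which are semialgebraic as polynomial
    images. *)
Lemma semialgebraic_srank_set (R : rcfType) n d r :
  semialgebraic (@srank_set R n d r).
Proof.
have sa q : semialgebraic (@cone_sumset R n d q).
  rewrite (_ : cone_sumset q = [set x : tensor R n d |
    exists v, forall t, x t = (cone_poly R q t).@[v]]%classic).
    exact: semialgebraic_image.
  apply/seteqP; split=> T /= => [/cone_sumsetP[v ->]|[v vP]].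
    by exists v => t; rewrite ffunE.
  by apply/cone_sumsetP; exists v; apply/ffunP => t; rewrite ffunE.
rewrite (_ : srank_set r = cone_sumset r `&` [set T | forall q, (q < r)%N ->
  (~` cone_sumset q) T])%classic.
  apply: semialgebraic_setI => //; apply: semialgebraic_bigcap => q.
  exact: semialgebraic_setC.
by apply/seteqP; split=> T /= /has_srankE.
Qed.

Theorem theorem5p16 (R : realType) (n d r g : nat)
    (hg : is_generic_srank R[i] n d g)
    (hr : (r < g)%N)
    (hC : complex_identifiable R n d r) :
  real_identifiable R n d r.
Proof.
have [h1 [h1P [T1 T1r h1T1]]] := generic_srank_separation hg hr.
have [h2 [h2P [T2 /has_srankE[T2r _] h2T2]]] := general_point_separation hC.
have [f fP] := real_zero_locus_poly (h1 * h2).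
pose iota := real_complex R.
have fE (T : tensor R n d) :
    peval f T = 0 <-> peval h1 (tensor_map iota T) * peval h2 (tensor_map iota T) = 0.
  have hE a : peval a (tensor_map iota T) = a.@[fun j => iota (T (enum_val j))].
    by apply: meval_eq => j; rewrite ffunE.
  by rewrite !hE -rmorphM; exact: fP.
(* A real sum of fewer than [r] cone elements is also a complex one, where [h1] vanishes. *)
have rank_r (T : tensor R n d) : cone_sumset r T -> peval f T != 0 -> srank_set r T.
  move=> Tr fT; apply/has_srankE; split=> // q qr Tq; move/eqP: fT; apply.
  by apply/fE; rewrite (h1P q) ?mul0r //; exact: cone_sumset_map.
have bad (T : tensor R n d) : srank_set r T -> ~ has_unique_decomp r T -> peval f T = 0.
  move=> /has_srankE[Tr _] nuT; apply/fE.
  (* If the complex rank is still [r], complex uniqueness would descend, so it fails and [h2]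
     vanishes; otherwise the complex rank is smaller and [h1] vanishes. *)
  have [Trank|] := pselect (has_srank (tensor_map iota T) r).
    rewrite h2P ?mulr0 // => uT; exact: nuT (has_unique_decomp_map Tr uT).
  have TCr := cone_sumset_map iota Tr.
  move=> nTr; suff [q [qr Tq]] : exists q, (q < r)%N /\ cone_sumset q (tensor_map iota T).
    by rewrite (h1P q) ?mul0r.
  apply: contrapT => /forallNP H; apply: nTr; apply/has_srankE; split=> // q qr Tq.
  by apply: (H q).
(* A natural point where both [h1] and [h2] are nonzero over the complex numbers is also a real
   parameter. *)
have [v0 fv0] : exists v : cone_vars n r -> R, peval f (cone_param d v) != 0.
  have [|v hv] := @cone_param_nat_neq0 R[i] n d r [:: h1; h2].
    by move=> a; rewrite mem_seq2 => /orP[]/eqP->; [exists T1|exists T2].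
  exists (fun j => (v j)%:R); apply/eqP => /fE; rewrite tensor_map_param_nat.
  by apply/eqP/mulf_neq0; apply: hv; rewrite !inE eqxx ?orbT.
have T0r : cone_sumset r (cone_param d v0) by apply/cone_sumsetP; exists v0.
exists (srank_set r `&` [set T | peval f T = 0])%classic; split.
- apply: semialgebraic_setI; first exact: semialgebraic_srank_set.
  exact: semialgebraic_eq0.
- by move=> T [].
- apply: (@dim_lt_prime _ _ _ _ f).
  + by move=> T [].
  + by exists (cone_param d v0); apply: rank_r.
  (* If [a] and [b] are both nonzero somewhere on [srank_set r], some natural point makes [a], [b]
     and [f] nonzero together; by [rank_r] its tensor has rank [r], so [a * b] does not vanish on
     [srank_set r]. *)
  + move=> a b Sab; have [?|Sa] := pselect (vanishing_ideal (srank_set r) a); first by left.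
    right=> U SU; apply/eqP; apply: contrapT => /negP bU; apply: Sa => T ST.
    apply/eqP; apply: contrapT => /negP aT.
    have [/has_srankE[Ur _] /has_srankE[Tr _]] := (SU, ST).
    have [|v vP] := @cone_param_nat_neq0 R n d r [:: a; b; f].
      move=> c; rewrite !inE => /or3P[]/eqP->; first by exists T.
        by exists U.
      by exists (cone_param d v0).
    have /Sab/eqP : srank_set r (cone_param d (fun j => (v j)%:R : R)).
      apply: rank_r; first by apply/cone_sumsetP; eexists.
      by apply: vP; rewrite !inE eqxx !orbT.
    rewrite /peval rmorphM /= -!/(peval _ _); apply/negP/mulf_neq0; apply: vP.
      by rewrite inE eqxx.
    by rewrite !inE eqxx orbT.
  + by move=> T [].
  + by move/(_ _ (rank_r _ T0r fv0))/eqP; apply/negP.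
by move=> T ST nuT; split=> //; exact: bad.
Qed.
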